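(* Let $Q>0$ (the vehicle capacity), let $\lambda>0$, and let $S$ be a finite set of customers whose demands $\xi_i$, $i\in S$, are independent Erlang random variables, $\xi_i\sim\mathrm{Erlang}(n_i,\lambda)$, sharing the common rate parameter $\lambda$, with total expected value $\sum_{i\in S}n_i/\lambda\le Q$. Then $S$ respects the monotonicity condition.
   Context: Monotonicity condition: a finite set $S$ of customers with independent random demands $\xi_i$ ($i\in S$) respects the monotonicity condition (with respect to the capacity $Q$) if, for every pair $(a,b)\in S\times S$ with $a\ne b$, every subset $\tilde S\subseteq S\setminus\{a,b\}$ (possibly empty) and every positive integer $l$, $$\mathbb{P}\left(\tilde\xi+\xi_a\le lQ<\tilde\xi+\xi_a+\xi_b\right)\ \ge\ \mathbb{P}\left(\tilde\xi\le lQ<\tilde\xi+\xi_b\right),\qquad \tilde\xi=\sum_{i\in\tilde S}\xi_i .$$ $\mathrm{Erlang}(n_i,\lambda)$, with $n_i$ a positive integer, is the distribution of the sum of $n_i$ independent exponential random variables of rate $\lambda$. *)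

(* Defs.v *)
From HB Require Import structures.
From mathcomp Require Import all_boot all_order all_algebra.
From mathcomp Require Import all_classical all_reals all_analysis.

Set Implicit Arguments.
Unset Strict Implicit.
Unset Printing Implicit Defensive.

Import Order.TTheory GRing.Theory Num.Theory.

Local Open Scope classical_set_scope.
Local Open Scope ring_scope.

Definition mutually_independent (d : measure_display) (T : measurableType d)
    (R : realType) (P : probability T R) (I : finType) (S : {set I})
    (X : I -> {RV P >-> R}) : Prop :=
  forall J : {set I}, J \subset S ->
  forall B : I -> set R, (forall i, i \in J -> measurable (B i)) ->
    P [set w | forall i, i \in J -> B i (X i w)] =
    (\prod_(i in J) P (X i @^-1` B i))%E.

(* Laws are compared on measurable sets only: the values that [distribution]
   and [exponential_prob] take on the other sets carry no information. *)
Definition exponential_rv (d : measure_display) (T : measurableType d)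
    (R : realType) (P : probability T R) (lambda : R) (X : {RV P >-> R}) : Prop :=
  forall A : set R, measurable A -> distribution P X A = exponential_prob lambda A.

(* X has the law of a sum of n independent exponential variables of rate
   lambda; these may live on a probability space other than that of X. *)
Definition erlang_rv (d : measure_display) (T : measurableType d)
    (R : realType) (P : probability T R) (n : nat) (lambda : R)
    (X : {RV P >-> R}) : Prop :=
  exists (d' : measure_display) (T' : measurableType d') (P' : probability T' R)
         (E : 'I_n -> {RV P' >-> R}),
    [/\ mutually_independent [set: 'I_n]%SET E,
        forall k : 'I_n, exponential_rv lambda (E k) &
        forall A : set R, measurable A ->
          distribution P X A = P' [set w | A (\sum_(k < n) E k w)]].

Definition monotonicity_condition (d : measure_display) (T : measurableType d)
    (R : realType) (P : probability T R) (Q : R) (I : finType) (S : {set I})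
    (xi : I -> {RV P >-> R}) : Prop :=
  forall a b : I, a \in S -> b \in S -> a != b ->
  forall St : {set I}, St \subset (S :\: [set a; b])%SET ->
  forall l : nat, (0 < l)%N ->
    (P [set w | (\sum_(i in St) xi i w <= l%:R * Q
                 < \sum_(i in St) xi i w + xi b w)%R]
     <= P [set w | (\sum_(i in St) xi i w + xi a w <= l%:R * Q
                    < \sum_(i in St) xi i w + xi a w + xi b w)%R])%E.

(* Main.v *)
Require Import Defs.
From HB Require Import structures.
From mathcomp Require Import all_boot all_order all_algebra.
From mathcomp Require Import all_classical all_reals all_analysis.
From mathcomp Require Import measurable_realfun ring lra.

(* Let [N] be a Poisson variable of mean [mu = lambda * l * Q].  A sum of
   independent Erlang demands is Erlang, and [Erlang(m, lambda) <= l * Q] has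
   the probability of [m <= N]; since demands are almost surely nonnegative,
   the two probabilities to be compared are those of [m <= N < m + q] and of
   [m + p <= N < m + p + q], where [m], [p], [q] are the shape parameters of
   the set [St], of [a] and of [b].  The mean hypothesis gives
   [m + p + q <= mu], and the Poisson weights [mu ^ k / k!] are nondecreasing
   for [k <= mu]. *)

Set Implicit Arguments.
Unset Strict Implicit.
Unset Printing Implicit Defensive.

Import Order.TTheory GRing.Theory Num.Theory.
Import numFieldNormedType.Exports.

Local Open Scope classical_set_scope.
Local Open Scope ring_scope.

(** * Product of two probability measures *)

Section product_probability.
Context d1 d2 (T1 : measurableType d1) (T2 : measurableType d2) (R : realType).
Variables (mu : probability T1 R) (nu : probability T2 R).

Let product_setT : (mu \x nu)%E [set: T1 * T2] = 1%E.
Proof.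
by rewrite -setXTT product_measure1E//= !probability_setT mule1.
Qed.

HB.instance Definition _ :=
  Measure_isProbability.Build _ _ _ (mu \x nu)%E product_setT.

End product_probability.

(** * Convolution of laws on the real line *)

Section convolution_probability.
Context {R : realType}.
Implicit Types mu nu rho : probability R R.

Definition add_pair (p : R * R) : R := p.1 + p.2.

Lemma measurable_add_pair : measurable_fun [set: R * R] add_pair.
Proof. exact: measurable_funD. Qed.

HB.instance Definition _ :=
  isMeasurableFun.Build _ _ _ _ add_pair measurable_add_pair.

(** As an image law it is again a [probability], so convolutions can be iterated. *)
Definition convolution mu nu : probability R R :=
  distribution (mu \x nu)%E add_pair.

Lemma convolutionE mu nu (A : set R) :
  convolution mu nu A = (\int[mu]_x nu [set y | A (x + y)%R])%E.
Proof.
apply: eq_integral => x _ /=; congr (nu _).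
by apply/seteqP; split => y; rewrite /xsection/= inE.
Qed.

Lemma ge0_integral_convolution mu nu (f : R -> \bar R) :
  measurable_fun setT f -> (forall x, 0 <= f x)%E ->
  (\int[convolution mu nu]_z f z = \int[mu]_x \int[nu]_y f (x + y)%R)%E.
Proof.
move=> mf f0; rewrite ge0_integral_distribution//=.
by rewrite fubini_tonelli1//; exact: measurableT_comp.
Qed.

Lemma measurable_shift (A : set R) x : measurable A ->
  measurable [set y | A (x + y)].
Proof.
move=> mA; rewrite -[X in measurable X]setTI.
suff : measurable_fun setT (fun y : R => x + y) by apply.
exact: measurable_funD.
Qed.

Lemma measurable_fun_shift nu (A : set R) : measurable A ->
  measurable_fun setT (fun x : R => nu [set y | A (x + y)]).
Proof.
move=> mA.
rewrite (_ : (fun x => _) = nu \o xsection (add_pair @^-1` A)).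
  apply: measurable_fun_xsection.
  by rewrite -[X in measurable X]setTI; exact: measurable_add_pair.
apply/funext => x /=; congr (nu _).
by apply/seteqP; split => y; rewrite /xsection/= inE.
Qed.

(** Both sides unfold to the same iterated integral, of the [rho]-measure of the [z] with
    [x + y + z] in [A]. *)
Lemma convolutionA mu nu rho (A : set R) : measurable A ->
  convolution (convolution mu nu) rho A = convolution mu (convolution nu rho) A.
Proof.
move=> mA; rewrite !convolutionE.
rewrite ge0_integral_convolution//; last exact: measurable_fun_shift.
apply: eq_integral => x _; rewrite convolutionE; apply: eq_integral => y _.
by congr (rho _); apply/seteqP; split => z /=; rewrite addrA.
Qed.

(** Laws are known to agree on measurable sets only, so rewriting inside a convolution goes through
    this congruence. *)
Lemma eq_convolution mu1 mu2 nu1 nu2 (A : set R) :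
  (forall B, measurable B -> mu1 B = mu2 B) ->
  (forall B, measurable B -> nu1 B = nu2 B) ->
  measurable A -> convolution mu1 nu1 A = convolution mu2 nu2 A.
Proof.
move=> emu enu mA; rewrite !convolutionE.
rewrite (eq_measure_integral mu2); last by move=> B mB _; exact: emu.
by apply: eq_integral => x _; apply: enu; exact: measurable_shift.
Qed.

Lemma convolution_dirac0r mu (A : set R) : measurable A ->
  convolution mu \d_(0 : R) A = mu A.
Proof.
move=> mA; rewrite convolutionE -[in RHS](setIT A) -integral_indic//.
apply: eq_integral => x _; rewrite [LHS]diracE indicE.
suff -> : (0 \in [set y | A (x + y)]) = (x \in A) by [].
by apply/idP/idP; rewrite !inE/= addr0.
Qed.

Lemma convolution_dirac0l mu (A : set R) : measurable A ->
  convolution \d_(0 : R) mu A = mu A.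
Proof.
move=> mA; rewrite convolutionE.
rewrite integral_dirac//; last exact: measurable_fun_shift.
rewrite diracT mul1e; congr (mu _).
by apply/seteqP; split => y /=; rewrite add0r.
Qed.

(** A negative sum has a negative term, so the event is covered by two null strips of the plane. *)
Lemma convolution_lt0 mu nu :
  mu `]-oo, 0[%classic = 0%E -> nu `]-oo, 0[%classic = 0%E ->
  convolution mu nu `]-oo, 0[%classic = 0%E.
Proof.
move=> mu0 nu0.
apply/eqP; rewrite eq_le measure_ge0 andbT.
rewrite -[leLHS]/((mu \x nu)%E (add_pair @^-1` `]-oo, 0[%classic)).
apply: (@le_trans _ _ ((mu \x nu)%E
   ((`]-oo, 0[%classic `*` setT) `|` (setT `*` `]-oo, 0[%classic)))).
  apply: le_measure => /=; rewrite ?inE.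
  - rewrite -[X in measurable X]setTI.
    by apply: measurable_add_pair => //; exact: measurable_itv.
  - by apply: measurableU; apply: measurableX => //; exact: measurable_itv.
  - move=> -[x y]; rewrite /add_pair/= in_itv/= => xy0.
    have [x0|x0] := ltP x 0; [left|right]; split; rewrite //= in_itv//=.
    by apply: le_lt_trans xy0; rewrite lerDr.
apply: le_trans (measureU2 _ _ _) _.
- by apply: measurableX => //; exact: measurable_itv.
- by apply: measurableX => //; exact: measurable_itv.
rewrite /= !product_measure1E//=; try exact: measurable_itv.
by rewrite mu0 nu0 mule0 mul0e adde0.
Qed.

Fixpoint convolution_pow nu (n : nat) : probability R R :=
  if n is n'.+1 then convolution (convolution_pow nu n') nu else \d_(0 : R).

Lemma convolution_pow1 nu (A : set R) :
  measurable A -> convolution_pow nu 1 A = nu A.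
Proof. exact: convolution_dirac0l. Qed.

Lemma convolution_powD nu m n (A : set R) : measurable A ->
  convolution_pow nu (m + n) A =
  convolution (convolution_pow nu m) (convolution_pow nu n) A.
Proof.
elim: n A => [A mA|n IHn A mA]; first by rewrite addn0 convolution_dirac0r.
rewrite addnS; apply: etrans (convolutionA _ _ _ mA).
exact: (@eq_convolution _ _ _ _ A IHn).
Qed.

Lemma convolution_pow_lt0 nu n :
  nu `]-oo, 0[%classic = 0%E -> convolution_pow nu n `]-oo, 0[%classic = 0%E.
Proof.
move=> nu0; elim: n => [|n IHn]; last exact: convolution_lt0.
by rewrite [LHS]diracE memNset//= in_itv/= ltxx.
Qed.

End convolution_probability.

(** * The exponential law, as a probability on [R] *)

Section exponential_law.
Context {R : realType} {lambda : R} (lambda_gt0 : 0 < lambda).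

(* [exponential_prob] lives on [measurableTypeR R], which carries the same
   sigma-algebra as [R] under another display; [idTR] transports it. *)
Let idTR : measurableTypeR R -> R := idfun.

#[local] HB.instance Definition _ :=
  @isMeasurableFun.Build _ _ _ _ idTR (@measurable_id _ _ setT).

Definition exponential_law : probability R R := distribution
  (exponential_distribution_exponential_prob__canonical__probability_measure_Probability
     lambda_gt0) idTR.

Lemma exponential_law_lt0 : exponential_law `]-oo, 0[%classic = 0%E.
Proof.
rewrite [LHS]integral0_eq// => x; rewrite /= in_itv/= => x0.
by rewrite lt0_exponential_pdf.
Qed.

End exponential_law.

(** * Truncated exponential series *)

Section exp_sum.
Context {R : realType}.
Implicit Types u x : R.

(** With [n] terms rather than degree [n], the case [n = 0] is the zero function; it will match the
    Dirac law at 0, the empty sum of exponentials. *)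
Definition exp_sum (n : nat) u := \sum_(k < n) u ^+ k / (k`!)%:R.

Lemma exp_sum_recl n u :
  exp_sum n.+1 u = 1 + \sum_(k < n) u ^+ k.+1 / (k.+1`!)%:R.
Proof. by rewrite /exp_sum big_ord_recl expr0 fact0 divr1. Qed.

Lemma is_derive_exp_sum n x : is_derive x 1 (exp_sum n.+1) (exp_sum n x).
Proof.
elim: n => [|n IHn].
  rewrite (_ : exp_sum 1 = cst 1); last first.
    by apply/funext => y; rewrite exp_sum_recl big_ord0 addr0.
  by rewrite /exp_sum big_ord0; exact: is_derive_cst.
rewrite (_ : exp_sum n.+2 = exp_sum n.+1 + (n.+1`!%:R)^-1 \*: (id ^+ n.+1)).
  rewrite /exp_sum big_ord_recr/= -/(exp_sum n x).
  apply: is_deriveD; apply: is_derive_eq.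
  rewrite /GRing.scale/= factS natrM mulr1 mulrA invfM mulrC; congr (_ * _).
  by rewrite mulrAC mulVf ?mul1r// pnatr_eq0.
by apply/funext => y; rewrite /exp_sum big_ord_recr/= exprfctE mulrC.
Qed.

Lemma continuous_exp_sum n : continuous (exp_sum n).
Proof.
case: n => [|n] x.
  rewrite (_ : exp_sum 0 = cst 0); first exact: cst_continuous.
  by apply/funext => y; rewrite /exp_sum big_ord0.
apply/differentiable_continuous/derivable1_diffP.
have := is_derive_exp_sum n x => ?; exact: ex_derive.
Qed.

End exp_sum.

(** * The Erlang distribution function *)

Section erlang_cdf.
Context {R : realType} (lambda : R).

(* The distribution function of the Erlang law, for [0 <= t] only. *)
Definition erlang_cdf (n : nat) (t : R) : R :=
  1 - expR (- (lambda * t)) * exp_sum n (lambda * t).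

(** Convolving with the exponential density raises the shape by one. *)
Lemma integral_erlang_cdf n (t : R) : 0 <= t ->
  (\int[lebesgue_measure]_(x in `[0%R, t])
    (erlang_cdf n (t - x) * (lambda * expR (- lambda * x)))%:E =
  (erlang_cdf n.+1 t)%:E)%E.
Proof.
(* The fundamental theorem of calculus is applied on a nondegenerate interval, so [t = 0] is treated
   apart. *)
rewrite le_eqVlt => /predU1P[<-|t0].
  rewrite set_itv1 integral_set1 /erlang_cdf mulr0 oppr0 expR0 mul1r.
  rewrite exp_sum_recl big1 ?addr0 ?subrr// => k _.
  by rewrite expr0n/= mul0r.
(* An antiderivative of the integrand: the factors [expR (- (lambda * (t - x)))] and
   [expR (- lambda * x)] multiply to the constant [expR (- (lambda * t))], which leaves a truncated
   series and an exponential to integrate. Moreover [G t = 0] and [G 0 = - erlang_cdf n.+1 t]. *)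
pose G x := expR (- (lambda * t)) * exp_sum n.+1 (lambda * (t - x)) -
  expR (- lambda * x).
have dG x : is_derive x (1 : R) G
    (erlang_cdf n (t - x) * (lambda * expR (- lambda * x))).
  have L : is_derive x 1 (fun x : R => lambda * (t - x)) (- lambda).
    by apply: is_derive_eq; rewrite /GRing.scale/=; ring.
  have L' : is_derive x 1 (fun x : R => - lambda * x) (- lambda).
    by apply: is_derive_eq; rewrite /GRing.scale/=; ring.
  have E1 := @is_derive1_comp _ (exp_sum n.+1) _ x _ _
    (is_derive_exp_sum _ _) L.
  have E2 := @is_derive1_comp _ expR _ x _ _ (is_derive_expR _) L'.
  have := is_deriveB (is_deriveZ (expR (- (lambda * t))) E1) E2.
  move=> /is_derive_eq; apply.
  rewrite /erlang_cdf /GRing.scale/=.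
  have -> : - (lambda * t) = - (lambda * (t - x)) + - lambda * x by ring.
  by rewrite expRD; ring.
have cG : continuous G.
  move=> x; apply/differentiable_continuous/derivable1_diffP; exact: ex_derive.
rewrite (@continuous_FTC2 _ _ G)//.
- rewrite /G subrr mulr0 subr0 mulr0 expR0 -EFinB; congr EFin.
  rewrite /erlang_cdf exp_sum_recl big1 ?addr0; last first.
    by move=> k _; rewrite expr0n/= mul0r.
  by rewrite mulNr; ring.
- apply: continuous_subspaceT => x.
  apply: cvgM; last first.
    apply: cvgM; first exact: cvg_cst.
    apply: continuous_comp; last exact: continuous_expR.
    by apply: cvgM; [exact: cvg_cst|exact: cvg_id].
  apply: cvgB; first exact: cvg_cst.
  have cL : (fun x : R => lambda * (t - x)) @ x --> lambda * (t - x).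
    apply: cvgM; first exact: cvg_cst.
    by apply: cvgB; [exact: cvg_cst|exact: cvg_id].
  apply: cvgM.
    apply: (@continuous_comp _ _ _ (fun x => - (lambda * (t - x))) expR).
      by apply: cvgN.
    exact: continuous_expR.
  apply: (@continuous_comp _ _ _ (fun x => lambda * (t - x)) (exp_sum n)) => //.
  exact: continuous_exp_sum.
- split.
  + by move=> x _; exact: ex_derive.
  + exact/cvg_at_right_filter/cG.
  + exact/cvg_at_left_filter/cG.
- by move=> x _; rewrite derive1E derive_val.
Qed.

Hypothesis lambda_gt0 : 0 < lambda.

Notation Exp := (exponential_law lambda_gt0).

(* Fubini against Lebesgue measure turns the integral with respect to the
   first law into one against the exponential density. *)
Lemma convolution_exponentialE (mu : probability R R) (A : set R) :
  measurable A ->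
  convolution mu Exp A = (\int[lebesgue_measure]_x
    (mu [set y | A (y + x)%R] * (exponential_pdf lambda x)%:E))%E.
Proof.
move=> mA; rewrite convolutionE.
pose f (p : R * measurableTypeR R) : \bar R :=
  ((\1_[set q : R * R | A (q.1 + q.2)] (p : R * R))%:E *
   (exponential_pdf lambda p.2)%:E)%E.
have mf : measurable_fun setT f.
  apply: emeasurable_funM.
    apply/measurable_EFinP.
    apply: (@measurable_indic _ (R * measurableTypeR R)%type).
    rewrite -[X in measurable X]setTI.
    suff : measurable_fun setT
      (fun q : R * measurableTypeR R => q.1 + q.2 : R) by apply.
    exact: (@measurable_funD _ (R * measurableTypeR R)%type).
  apply/measurable_EFinP.
  apply: measurableT_comp => //.
  exact: measurable_exponential_pdf.
have f0 p : (0 <= f p)%E.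
  by rewrite mule_ge0// lee_fin// exponential_pdf_ge0// ltW.
transitivity (\int[mu]_x fubini_F
    (lebesgue_measure : set (measurableTypeR R) -> \bar R) f x)%E.
  apply: eq_integral => x _.
  rewrite /fubini_F /f [LHS]integral_mkcond.
  apply: eq_integral => y _; rewrite patchE/= indicE.
  have -> : ((x, y) \in [set q : R * R | A (q.1 + q.2)]) =
      (y \in [set y | A (x + y)]).
    by apply/idP/idP; rewrite !inE.
  by case: ifPn; rewrite ?mul1e ?mul0e.
rewrite fubini_tonelli//.
apply: eq_integral => x _; rewrite /fubini_G /f/=.
have mAx : measurable [set y | A (y + x)].
  rewrite (_ : mkset _ = [set y | A (x + y)]); first exact: measurable_shift.
  by apply/seteqP; split => y /=; rewrite addrC.
have EAx y : (\1_[set q : R * R | A (q.1 + q.2)] (y, x : R) : R) =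
    \1_[set y | A (y + x)] y.
  rewrite !indicE.
  suff -> : ((y, x : R) \in [set q : R * R | A (q.1 + q.2)]) =
    (y \in [set y | A (y + x)]) by [].
  by apply/idP/idP; rewrite !inE.
under eq_integral => y _ do rewrite EAx.
rewrite ge0_integralZr//=.
- by rewrite integral_indic// setIT.
- exact/measurable_EFinP/measurable_indic.
- by rewrite lee_fin exponential_pdf_ge0// ltW.
Qed.

(** Induction on [n], the step being [integral_erlang_cdf] once the integral over the line is cut
    down to [[0, t]]. *)
Lemma convolution_pow_exponential_itv n (t : R) : 0 <= t ->
  convolution_pow Exp n `]-oo, t]%classic = (erlang_cdf n t)%:E.
Proof.
elim: n t => [t t0|n IHn t t0].
  rewrite [LHS]diracE mem_set/= ?in_itv//=.
  by rewrite /erlang_cdf /exp_sum big_ord0 mulr0 subr0.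
rewrite [LHS]convolution_exponentialE; last exact: measurable_itv.
rewrite -integral_erlang_cdf// [RHS]integral_mkcond.
apply: eq_integral => x _; rewrite patchE.
have shiftE : [set y : R | `]-oo, t]%classic (y + x)] = `]-oo, t - x]%classic.
  by apply/seteqP; split => y; rewrite /= !in_itv/= lerBrDr.
rewrite shiftE; case: ifPn => [|]; rewrite ?inE ?notin_setE/= in_itv/=.
  by move=> /andP[x0 xt]; rewrite IHn ?subr_ge0// exponential_pdfE// EFinM.
(* Off [[0, t]] the integrand vanishes: for [x < 0] through the density, for [x > t] because the
   convolution power gives no mass to the negative reals. *)
move=> /negP; rewrite negb_and -!ltNge => /orP[x0|xt].
  by rewrite lt0_exponential_pdf// mule0.
suff -> : convolution_pow Exp n `]-oo, t - x]%classic = 0%E by rewrite mul0e.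
apply/eqP; rewrite eq_le measure_ge0 andbT.
rewrite -(convolution_pow_lt0 n (exponential_law_lt0 lambda_gt0)).
apply: le_measure; rewrite ?inE; try exact: measurable_itv.
move=> y; rewrite /= !in_itv/= => /le_lt_trans; apply.
by rewrite subr_lt0.
Qed.

End erlang_cdf.

Section mscale_finite.
Context d (T : measurableType d) (R : realType).
Variables (k : {nonneg R}) (m : {finite_measure set T -> \bar R}).

(** Serves the uniqueness argument for product measures below, where a law is scaled by the
    probability of an event and is in general no longer a probability. *)
Let mscale_fin : fin_num_fun (mscale k m).
Proof. by move=> A mA; rewrite /mscale fin_numM// fin_num_measure. Qed.

HB.instance Definition _ :=
  Measure_isFinite.Build _ _ _ (mscale k m) mscale_fin.

End mscale_finite.

(** * Law of a sum of independent variables *)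

Section sum_of_independent.
Context d (T : measurableType d) (R : realType) (P : probability T R).
Variables (I : finType) (S : {set I}) (X : I -> {RV P >-> R}) (n : I -> nat).
Variable nu : probability R R.
Hypothesis X_indep : mutually_independent S X.
Hypothesis X_law : forall i, i \in S -> forall A : set R, measurable A ->
  distribution P (X i) A = convolution_pow nu (n i) A.

Lemma measurable_box (K : {set I}) (B : I -> set R) :
  (forall i, i \in K -> measurable (B i)) ->
  measurable [set w | forall i, i \in K -> B i (X i w)].
Proof.
move=> mB.
rewrite (_ : mkset _ = \bigcap_(i in [set i | i \in K]) X i @^-1` B i) //.
apply: fin_bigcap_measurable => [|i /= iK]; first exact: (@finite_finset I).
rewrite -[X in measurable X]setTI.
exact: (measurable_funPT (X i) measurableT _ (mB _ iK)).
Qed.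

Lemma measurable_sum_RV (J : {set I}) :
  measurable_fun setT (fun w => \sum_(i in J) X i w).
Proof.
rewrite (_ : (fun w => _) = fun w => \sum_(i <- enum J) X i w); last first.
  by apply/funext => w; rewrite big_enum.
by apply: measurable_sum => i; exact: measurable_funPT.
Qed.

(* The spectator event indexed by [K] lets the induction on [J] peel one
   variable off the sum using only the product rule. *)
Lemma distribution_sum_indep (J K : {set I}) (A : set R) (B : I -> set R) :
  J \subset S -> K \subset (S :\: J)%SET ->
  measurable A -> (forall i, i \in K -> measurable (B i)) ->
  P ([set w | A (\sum_(i in J) X i w)] `&`
     [set w | forall i, i \in K -> B i (X i w)]) =
  (convolution_pow nu (\sum_(i in J) n i) A *
   \prod_(i in K) P (X i @^-1` B i))%E.
Proof.
(* [K] and [B] are generalized because the index removed from [J] joins the spectators. *)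
have [N] := ubnP #|J|; elim: N J K A B => // N IHN J K A B JN JS KSJ mA mB.
have mE := measurable_box mB.
set E := [set w | forall i, i \in K -> B i (X i w)] in mE *.
have PE : P E = (\prod_(i in K) P (X i @^-1` B i))%E.
  by apply: X_indep => //; apply: fintype.subset_trans KSJ _; exact: subsetDl.
have [->|/set0Pn[j jJ]] := eqVneq J finset.set0.
  rewrite big_set0 -PE (_ : convolution_pow nu 0 A = (\1_A 0)%:E)// indicE.
  have [A0|nA0] := pselect (A 0).
    rewrite mem_set// mul1e; congr (P _).
    by apply/seteqP; split => w; rewrite /= big_set0 => // -[].
  rewrite memNset// mul0e -(measure0 P); congr (P _).
  by apply/seteqP; split => w //=; rewrite big_set0 => -[].
pose J' := (J :\ j)%SET; pose c := fine (P E).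
have jK : j \notin K.
  by apply/negP => /(fintype.subsetP KSJ); rewrite finset.in_setD jJ.
have jS : j \in S by exact: (fintype.subsetP JS).
have PEc : P E = c%:E by rewrite /c fineK// fin_num_measure.
have c0 : 0 <= c by rewrite /c fine_ge0.
pose Y w := \sum_(i in J') X i w.
have mY : measurable_fun setT Y by exact: measurable_sum_RV.
pose Z (w : T) : R * R := (Y w, X j w).
have mZ : measurable_fun setT Z by exact: measurable_fun_pair.
(* The joint law of the remaining sum and of [X j], restricted to the spectator event [E]. It is
   shown to be a product measure whose first factor carries the mass [c] of [E]. *)
pose mZP : {measure set (R * R) -> \bar R} :=
  @measure_function_pushforward__canonical__measure_function_Measure
    _ _ _ _ _ (mrestr P mE) _ mZ.
pose m1 : {finite_measure set R -> \bar R} :=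
  mscale (NngNum c0) (convolution_pow nu (\sum_(i in J') n i)).
have ZE A1 A2 : measurable A1 -> measurable A2 ->
    mZP (A1 `*` A2) = (m1 A1 * convolution_pow nu (n j) A2)%E.
  move=> mA1 mA2.
  (* On a rectangle, the constraint on [X j] becomes one more spectator constraint, and the
     induction hypothesis applies to [J']. *)
  pose B' i := if i == j then A2 else B i.
  have B'E i : i \in K -> B' i = B i.
    by move=> iK; rewrite /B' ifN//; apply: contraNneq jK => <-.
  have -> : mZP (A1 `*` A2) = P ([set w | A1 (\sum_(i in J') X i w)] `&`
      [set w | forall i, i \in (j |: K)%SET -> B' i (X i w)]).
    rewrite [LHS]/(P _); congr (P _); apply/seteqP; split => w /=.
      move=> [[YA1 XA2] Ew]; split => // i; rewrite in_setU1 => /predU1P[->|iK].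
        by rewrite /B' eqxx.
      by rewrite B'E//; exact: Ew.
    move=> [YA1 B'w]; split; first split=> //.
      by have := B'w j (setU11 _ _); rewrite /B' eqxx.
    by move=> i iK; rewrite -B'E//; apply: B'w; rewrite in_setU1 iK orbT.
  rewrite IHN//; last 4 first.
  - by move: JN; rewrite (cardsD1 j) jJ.
  - by apply: fintype.subset_trans JS; exact: subD1set.
  - apply/fintype.subsetP => i; rewrite in_setU1 => /predU1P[->|iK].
      by rewrite finset.in_setD jS setD11.
    have := fintype.subsetP KSJ _ iK; rewrite !finset.in_setD => /andP[iJ ->].
    by rewrite (negbTE iJ) andbF.
  - move=> i; rewrite in_setU1 => /predU1P[->|iK]; first by rewrite /B' eqxx.
    by rewrite B'E//; exact: mB.
  rewrite big_setU1//= /B' eqxx -/(B' _) -X_law//.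
  rewrite (eq_bigr (fun i => P (X i @^-1` B i))); last first.
    by move=> i iK; rewrite -/(B' _) B'E.
  by rewrite -PE PEc /m1 /mscale/= muleA muleC muleA.
have mA' : measurable (add_pair @^-1` A : set (R * R)).
  by rewrite -[X in measurable X]setTI; exact: measurable_add_pair.
(* Agreement on rectangles extends to the preimage of [A] under addition, whose product measure is
   [c] times a convolution. *)
have := product_measure_unique ZE mA'.
rewrite -PE PEc.
have -> : mZP (add_pair @^-1` A) = P ([set w | A (\sum_(i in J) X i w)] `&` E).
  rewrite [LHS]/(P _); congr (P _); apply/seteqP; split => w /=.
    by rewrite (big_setD1 j)//= addrC.
  by rewrite (big_setD1 j)//= addrC.
move=> <-.
rewrite (big_setD1 j)//= addnC convolution_powD// muleC.
rewrite [LHS]ge0_integral_mscale//=.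
exact: measurable_fun_xsection.
Qed.

(** Used twice with [nu] exponential: with all exponents 1 to identify an Erlang law, then with the
    shapes [n] to add up demands. *)
Lemma distribution_sum (J : {set I}) (A : set R) :
  J \subset S -> measurable A ->
  P [set w | A (\sum_(i in J) X i w)] =
  convolution_pow nu (\sum_(i in J) n i) A.
Proof.
move=> JS mA.
have := @distribution_sum_indep J finset.set0 A (fun=> setT) JS.
rewrite big_set0 mule1 => <- //.
- by congr (P _); apply/seteqP; split => w; [|case] => //= ?;
    split => // i; rewrite finset.in_set0.
- exact: finset.sub0set.
Qed.

End sum_of_independent.

(** The exponential variables may live on another space; the convolution power is a description of
    the law free of that space. *)
Lemma erlang_rv_law d (T : measurableType d) (R : realType)
    (P : probability T R) (m : nat) (lambda : R) (lambda_gt0 : 0 < lambda)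
    (X : {RV P >-> R}) : erlang_rv m lambda X ->
  forall A : set R, measurable A ->
  distribution P X A = convolution_pow (exponential_law lambda_gt0) m A.
Proof.
move=> [d' [T' [P' [E [E_indep E_exp X_sum]]]]] A mA; rewrite X_sum//.
have := @distribution_sum _ _ _ _ _ _ E (fun=> 1%N)
  (exponential_law lambda_gt0) E_indep _ [set: 'I_m]%SET A.
rewrite sum1_card cardsT card_ord => <- //; last first.
  by move=> k _ B mB; rewrite convolution_pow1//; exact: E_exp.
have sumE w : \sum_(k in [set: 'I_m]%SET) E k w = \sum_(k < m) E k w.
  by apply: eq_bigl => k; rewrite finset.in_setT.
by congr (P' _); apply/seteqP; split => w /=; rewrite sumE.
Qed.

(** * Probability that one more demand crosses a threshold *)

Section crossing.
Context d (T : measurableType d) (R : realType) (P : probability T R).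
Variables (I : finType) (S : {set I}) (X : I -> {RV P >-> R}) (n : I -> nat).
Variables (lambda : R) (lambda_gt0 : 0 < lambda).
Hypothesis X_indep : mutually_independent S X.
Hypothesis X_erlang : forall i, i \in S -> erlang_rv (n i) lambda (X i).

Let X_law i (iS : i \in S) := erlang_rv_law lambda_gt0 (X_erlang iS).

Lemma prob_sum_le (J : {set I}) (t : R) : J \subset S -> 0 <= t ->
  P [set w | \sum_(i in J) X i w <= t] =
  (erlang_cdf lambda (\sum_(i in J) n i) t)%:E.
Proof.
move=> JS t0; rewrite -(convolution_pow_exponential_itv lambda_gt0)//.
by rewrite -(distribution_sum X_indep X_law).
Qed.

Lemma prob_crossing (J : {set I}) (b : I) (t : R) :
  J \subset S -> b \in S -> b \notin J -> 0 <= t ->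
  P [set w | \sum_(i in J) X i w <= t < \sum_(i in J) X i w + X b w] =
  (erlang_cdf lambda (\sum_(i in J) n i) t -
   erlang_cdf lambda (\sum_(i in J) n i + n b) t)%:E.
Proof.
move=> JS bS bJ t0.
have bJS : (b |: J)%SET \subset S.
  by apply/fintype.subsetP => i /setU1P[->//|]; exact: (fintype.subsetP JS).
have mle (K : {set I}) : measurable [set w | \sum_(i in K) X i w <= t].
  rewrite -[X in measurable X]setTI.
  rewrite (_ : mkset _ =
    (fun w => \sum_(i in K) X i w) @^-1` `]-oo, t]%classic).
    by apply: measurable_sum_RV => //; exact: measurable_itv.
  by apply/seteqP; split => w; rewrite /= in_itv.
pose U := [set w | \sum_(i in J) X i w <= t].
pose V := [set w | \sum_(i in (b |: J)%SET) X i w <= t].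
have mU : measurable U by exact: mle.
have mV : measurable V by exact: mle.
have VE w : V w <-> \sum_(i in J) X i w + X b w <= t.
  by rewrite /V/= big_setU1//= addrC.
have -> : [set w | \sum_(i in J) X i w <= t < \sum_(i in J) X i w + X b w] =
    U `\` V.
  apply/seteqP; split => w /=.
    by move=> /andP[Jt tJ]; split => // /VE; rewrite leNgt tJ.
  by move=> [Ut /VE /negP]; rewrite -ltNge => tJ; apply/andP.
(* [V] need not be included in [U], as [X b] may take negative values; it does so on a null set
   only, which covers the part of [V] outside [U]. *)
have UV : P (U `&` V) = P V.
  apply/eqP; rewrite eq_le; apply/andP; split.
    apply: le_measure; rewrite ?inE; [exact: measurableI|exact: mV|].
    by move=> w [].
  have b0 : P (X b @^-1` `]-oo, 0[%classic) = 0%E.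
    rewrite -[LHS]/(distribution P (X b) _) X_law//.
    exact/convolution_pow_lt0/exponential_law_lt0.
  have mb : measurable (X b @^-1` `]-oo, 0[%classic).
    rewrite -[X in measurable X]setTI.
    by apply: measurable_funPT => //; exact: measurable_itv.
  rewrite -[leRHS]adde0 -b0.
  apply: le_trans (measureU2 _ _ _); [|exact: measurableI|exact: mb].
  apply: le_measure; rewrite ?inE; first exact: mV.
    by apply: measurableU => //; exact: measurableI.
  move=> w Vw; have [Uw|Uw] := pselect (U w); [by left|right].
  by move/VE : Vw; move/negP : Uw; rewrite /= -ltNge in_itv/=; lra.
have -> : P (U `\` V) = (P U - P (U `&` V))%E.
  by apply: measureD => //; rewrite -ge0_fin_numE// fin_num_measure.
by rewrite UV /U prob_sum_le// /V prob_sum_le// big_setU1//= addnC -EFinB.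
Qed.

End crossing.

(** * Comparison of Poisson weights *)

Lemma exp_term_le (R : realType) (mu : R) (j p : nat) :
  0 <= mu -> (j + p)%:R <= mu ->
  mu ^+ j / j`!%:R <= mu ^+ (j + p) / (j + p)`!%:R.
Proof.
move=> mu0; elim: p => [|p IHp] jp; first by rewrite addn0.
apply: le_trans (IHp _) _; first by apply: le_trans jp; rewrite ler_nat addnS.
(* The next weight is the current one times [mu / (j + p).+1], a ratio at least 1 by the bound on
   the index. *)
rewrite addnS exprS factS natrM invfM mulrACA ler_peMl//.
  by rewrite divr_ge0// exprn_ge0.
by rewrite ler_pdivlMr ?ltr0n// mul1r -addnS.
Qed.

(** Each difference is a sum of [q] consecutive Poisson weights, and the two windows, shifted by
    [p], are compared term by term. *)
Lemma erlang_cdfB_le (R : realType) (lambda t : R) (m p q : nat) :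
  0 <= lambda * t -> (m + p + q)%:R <= lambda * t ->
  erlang_cdf lambda m t - erlang_cdf lambda (m + q) t <=
  erlang_cdf lambda (m + p) t - erlang_cdf lambda (m + p + q) t.
Proof.
move=> mu0 mpq.
have cdfB k : erlang_cdf lambda k t - erlang_cdf lambda (k + q) t =
    expR (- (lambda * t)) * \sum_(i < q) (lambda * t) ^+ (k + i) / (k + i)`!%:R.
  by rewrite /erlang_cdf /exp_sum big_split_ord/=; ring.
rewrite !cdfB ler_wpM2l ?expR_ge0// ler_sum// => i _.
rewrite addnAC exp_term_le//; apply: le_trans mpq.
by rewrite ler_nat addnAC leq_add2l ltnW.
Qed.

Local Close Scope classical_set_scope.

Theorem proposition7 (d : measure_display) (T : measurableType d)
    (R : realType) (P : probability T R) (Q lambda : R)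
    (I : finType) (S : {set I}) (n : I -> nat) (xi : I -> {RV P >-> R})
    (hQ : 0 < Q) (hlambda : 0 < lambda)
    (hn : forall i, i \in S -> (0 < n i)%N)
    (hindep : mutually_independent S xi)
    (herlang : forall i, i \in S -> erlang_rv (n i) lambda (xi i))
    (hmean : \sum_(i in S) (n i)%:R / lambda <= Q) :
  monotonicity_condition Q S xi.
Proof.
move=> a b aS bS ab St StS l l0.
have notinSt i : i \in [set a; b]%SET -> i \notin St.
  move=> iab; apply/negP => /(fintype.subsetP StS).
  by rewrite finset.in_setD iab.
have [aSt bSt] : a \notin St /\ b \notin St.
  by rewrite !notinSt// !finset.inE eqxx ?orbT.
have SS : St \subset S by apply: fintype.subset_trans StS _; exact: subsetDl.
have aSS : (a |: St)%SET \subset S.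
  by apply/fintype.subsetP => i /setU1P[->//|]; exact: (fintype.subsetP SS).
have baSt : b \notin (a |: St)%SET by rewrite in_setU1 negb_or eq_sym ab.
have t0 : 0 <= l%:R * Q by rewrite mulr_ge0// ltW.
rewrite (prob_crossing hlambda hindep herlang SS)//.
(* Absorbing [a] into the index set makes the second event a crossing by [b] as well. *)
have -> : [set w | (\sum_(i in St) xi i w + xi a w <= l%:R * Q
    < \sum_(i in St) xi i w + xi a w + xi b w)%R]%classic =
  [set w | (\sum_(i in (a |: St)%SET) xi i w <= l%:R * Q
    < \sum_(i in (a |: St)%SET) xi i w + xi b w)%R]%classic.
  by apply/seteqP; split => w /=; rewrite big_setU1//= addrC.
rewrite (prob_crossing hlambda hindep herlang aSS)// big_setU1//=.
rewrite lee_fin (addnC (n a)) erlang_cdfB_le//; first by rewrite mulr_ge0// ltW.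
have nQ : (\sum_(i in S) n i)%:R <= lambda * Q.
  by rewrite mulrC -ler_pdivrMr// natr_sum mulr_suml.
(* The mean hypothesis concerns a single capacity; [1 <= l] extends the bound to [l] capacities. *)
apply: (@le_trans _ _ (lambda * Q)); last first.
  by rewrite ler_pM2l// ler_peMl ?ler1n// ltW.
apply: le_trans nQ; rewrite ler_nat.
have KS : (b |: (a |: St))%SET \subset S.
  by apply/fintype.subsetP => i /setU1P[->//|]; exact: (fintype.subsetP aSS).
(* The three shapes belong to disjoint parts of [S], so they add up to at most the total shape. *)
rewrite [leqRHS](big_setID (b |: (a |: St))%SET)/= (finset.setIidPr KS).
by rewrite big_setU1//= big_setU1//= addnC (addnC _ (n a)) leq_addr.
Qed.
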